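(* Let $\mathcal{P}$ be a hereditary graph property, and let $d_\mathcal{P}$ denote the minimum possible degree of a minimal forbidden subgraph for $\mathcal{P}$. Then, as $n \to \infty$, \[ \mathrm{min\text{-}cost}_n(\mathcal{P}) = O\!\left(n^{1/(d_\mathcal{P}+1)}\right). \]
   Context: Node-query setting: a graph $G=(V,E)$ on $n$ vertices and a graph property $\mathcal{P}$ (a class of graphs) are fixed. An unknown subset $S \subseteq V$ is accessible only via queries of the form ''Does $i \in S$?''. $\mathrm{cost}(\mathcal{P},G)$ is the deterministic query complexity (minimum over decision trees of the worst-case number of queries) of deciding whether the induced subgraph $G[S]$ satisfies $\mathcal{P}$. A vertex $i$ of $G$ is relevant for $\mathcal{P}$ if there is some $S \ni i$ such that exactly one of $G[S]$ and $G[S\setminus\{i\}]$ satisfies $\mathcal{P}$; $G$ is relevant for $\mathcal{P}$ if all its vertices are relevant. Define $\mathrm{min\text{-}cost}_n(\mathcal{P}) = \min\{\mathrm{cost}(\mathcal{P},G) : G \text{ relevant for } \mathcal{P},\ |V(G)|=n\}$. A property is hereditary if it is closed under deletion of vertices and of edges; such a property is characterized by its (possibly infinite) family of minimal forbidden subgraphs (graphs not in $\mathcal{P}$ all of whose proper subgraphs are in $\mathcal{P}$), and a graph satisfies $\mathcal{P}$ iff it contains none of them as a subgraph. Here the degree of a forbidden subgraph $F$ means its minimum vertex degree, and $d_\mathcal{P}$ is the minimum of this over all minimal forbidden subgraphs $F$ of $\mathcal{P}$. *)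

(* Defs.v *)
From HB Require Import structures.
From mathcomp Require Import all_boot all_order all_algebra.
From mathcomp Require Import all_classical all_reals all_analysis.

Set Implicit Arguments.
Unset Strict Implicit.
Unset Printing Implicit Defensive.

(** * Finite simple graphs *)

Record sgraph : Type := SGraph {
  vertex :> finType;
  adj : rel vertex;
  adj_sym : symmetric adj;
  adj_irr : irreflexive adj }.

Definition iso (G H : sgraph) : Prop :=
  exists f : G -> H, bijective f /\ forall x y, adj (f x) (f y) = adj x y.

(** [subgraph H G]: some subgraph of [G] (not necessarily induced) is a copy
    of [H]. *)
Definition subgraph (H G : sgraph) : Prop :=
  exists f : H -> G, injective f /\ forall x y, adj x y -> adj (f x) (f y).

(** Since graphs are finite, a subgraph of [G] is isomorphic to [G] only if it
    is [G] itself. *)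
Definition proper_subgraph (H G : sgraph) : Prop :=
  subgraph H G /\ ~ iso H G.

Section Induced.
Variables (G : sgraph) (S : {set G}).

Definition induced_adj : rel {x : G | x \in S} :=
  fun x y => adj (val x) (val y).

Lemma induced_adj_sym : symmetric induced_adj.
Proof. by move=> x y; apply: adj_sym. Qed.

Lemma induced_adj_irr : irreflexive induced_adj.
Proof. by move=> x; apply: adj_irr. Qed.

Definition induced_graph : sgraph := SGraph induced_adj_sym induced_adj_irr.
End Induced.

Definition del_vertex (G : sgraph) (v : G) : sgraph := induced_graph [set~ v].

Section DelEdge.
Variables (G : sgraph) (u v : G).

Definition del_edge_adj : rel G :=
  fun x y => adj x y && ([set x; y] != [set u; v]).

Lemma del_edge_adj_sym : symmetric del_edge_adj.
Proof. by move=> x y; rewrite /del_edge_adj adj_sym finset.setUC. Qed.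

Lemma del_edge_adj_irr : irreflexive del_edge_adj.
Proof. by move=> x; rewrite /del_edge_adj adj_irr. Qed.

Definition del_edge : sgraph := SGraph del_edge_adj_sym del_edge_adj_irr.
End DelEdge.

Definition degree (G : sgraph) (v : G) : nat := #|[set w | adj v w]|.

(** No [d] qualifies when [G] is the graph with no vertices. *)
Definition is_min_degree (G : sgraph) (d : nat) : Prop :=
  (exists v : G, degree v = d) /\ (forall v : G, d <= degree v).

(** * Hereditary graph properties *)

Definition graph_property (P : sgraph -> Prop) : Prop :=
  forall G H, iso G H -> P G -> P H.

Definition hereditary (P : sgraph -> Prop) : Prop :=
  (forall (G : sgraph) (v : G), P G -> P (del_vertex v)) /\
  (forall (G : sgraph) (u v : G), adj u v -> P G -> P (del_edge u v)).

Definition minimal_forbidden (P : sgraph -> Prop) (F : sgraph) : Prop :=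
  ~ P F /\ forall H, proper_subgraph H F -> P H.

(** [is_forbidden_degree P d] says that [d_P] is defined and equal to [d].  It
    is undefined exactly when the hereditary property [P] holds of every graph
    or of no graph. *)
Definition is_forbidden_degree (P : sgraph -> Prop) (d : nat) : Prop :=
  (exists F, minimal_forbidden P F /\ is_min_degree F d) /\
  (forall F e, minimal_forbidden P F -> is_min_degree F e -> d <= e).

(** * Node queries *)

Inductive dtree (V : Type) : Type :=
| Leaf of bool
| Query of V & dtree V & dtree V.

Fixpoint depth (V : Type) (t : dtree V) : nat :=
  match t with
  | Leaf _ => 0
  | Query _ t0 t1 => (maxn (depth t0) (depth t1)).+1
  end.

(** The first subtree of [Query i t0 t1] is followed on the answer [i \notin S],
    the second one on the answer [i \in S]. *)
Fixpoint run (V : finType) (t : dtree V) (S : {set V}) : bool :=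
  match t with
  | Leaf b => b
  | Query i t0 t1 => if i \in S then run t1 S else run t0 S
  end.

Definition decides (P : sgraph -> Prop) (G : sgraph) (t : dtree G) : Prop :=
  forall S : {set G}, run t S <-> P (induced_graph S).

(** The least element of [A], or [0] if [A] is empty. *)
Definition nat_min (A : set nat) : nat :=
  xget 0 (fun m => A m /\ forall k, A k -> m <= k).

Lemma nat_minP (A : set nat) (n : nat) :
  A n -> A (nat_min A) /\ forall k, A k -> nat_min A <= k.
Proof.
move=> An; rewrite /nat_min.
have exA : exists m, (fun m => `[< A m >]) m by exists n; apply/asboolP.
case: (ex_minnP exA) => m /asboolP Am mmin.
apply: (@xgetPex _ 0 (fun m => A m /\ forall k, A k -> m <= k)).
by exists m; split=> // k Ak; apply: mmin; apply/asboolP.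
Qed.

Definition cost (P : sgraph -> Prop) (G : sgraph) : nat :=
  nat_min (fun c => exists t : dtree G, decides P t /\ depth t = c).

(** Querying every vertex decides [P], so [cost] is never a default value. *)
Lemma decides_exists (P : sgraph -> Prop) (G : sgraph) :
  exists t : dtree G, decides P t /\ depth t = #|G|.
Proof.
have gen (f : {set G} -> bool) (s : seq G) (A : {set G}) :
    exists t : dtree G, depth t = size s /\
      forall S : {set G}, run t S = f (A :|: [set x in s | x \in S]).
  elim: s A => [|x s IHs] A.
    exists (Leaf _ (f A)); split=> // S /=; congr f.
    by apply/setP=> y; rewrite !inE orbF.
  have [t0 [d0 r0]] := IHs A; have [t1 [d1 r1]] := IHs (x |: A).
  exists (Query x t0 t1); split=> [|S] /=; first by rewrite d0 d1 maxnn.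
  case: ifP => xS; rewrite (r0, r1); congr f; apply/setP=> y; rewrite !inE.
    by case: eqP => [->|]; rewrite ?xS ?orbT.
  by case: eqP => [->|]; rewrite ?xS ?andbF.
have [t [dt rt]] := gen (fun S => `[< P (induced_graph S) >]) (enum G) finset.set0.
exists t; split=> [S|]; last by rewrite dt cardE.
rewrite rt; have -> : finset.set0 :|: [set x in enum G | x \in S] = S.
  by apply/setP=> y; rewrite !inE mem_enum.
by split=> /asboolP.
Qed.

Definition relevant_vertex (P : sgraph -> Prop) (G : sgraph) (i : G) : Prop :=
  exists S : {set G},
    i \in S /\ ~ (P (induced_graph S) <-> P (induced_graph (S :\ i))).

Definition relevant (P : sgraph -> Prop) (G : sgraph) : Prop :=
  forall i : G, relevant_vertex P i.

(** [0] if there is no relevant graph on [n] vertices. *)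
Definition min_cost (P : sgraph -> Prop) (n : nat) : nat :=
  nat_min (fun c => exists G : sgraph,
    relevant P G /\ #|G| = n /\ cost P G = c).

(* Main.v *)
Require Import Defs.
From HB Require Import structures.
From mathcomp Require Import all_boot all_order all_algebra.
From mathcomp Require Import all_classical all_reals all_analysis.
From mathcomp Require Import zify.
Import Order.TTheory GRing.Theory Num.Theory.
Import numFieldNormedType.Exports.

(** Let [F] be a minimal forbidden graph with [k] vertices and a vertex [v] of
    degree [d].  Blow up every vertex of [F] into a clique of size [m] and add
    pendant vertices, each attached to one vertex in every clique of a neighbour
    of [v], at most [q] of them to the same vertices.  Every vertex lies in an
    induced copy of [F], so the graph is relevant.  To decide [P], query the
    [k m] clique vertices.  If [k] of them in one clique belong to [S], then
    [F] occurs.  Otherwise at most [k ^ d q] pendants have all their neighbours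
    in [S], and these are queried; the others have degree less than [d] in [G[S]]
    and so belong to no copy of a minimal forbidden graph.  There is room for
    [m ^ d q] pendants, and [q] is taken proportional to [m]. *)

Set Implicit Arguments.
Unset Strict Implicit.
Unset Printing Implicit Defensive.

(** * Subgraphs and the size of a finite graph *)

Definition edges (G : sgraph) : {set G * G} := [set e | adj e.1 e.2].

Definition graph_size (G : sgraph) : nat := #|G| + #|edges G|.

Lemma subgraph_refl (G : sgraph) : subgraph G G.
Proof. by exists id; split=> [x y|x y]. Qed.

Lemma subgraph_trans (H G K : sgraph) :
  subgraph H G -> subgraph G K -> subgraph H K.
Proof.
move=> [f [fi fh]] [g [gi gh]]; exists (g \o f); split; first exact: inj_comp.
by move=> x y /fh /gh.
Qed.

Lemma subgraph_leq_card (H G : sgraph) : subgraph H G -> #|H| <= #|G|.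
Proof. by move=> [f [fi _]]; apply: leq_card fi. Qed.

Lemma iso_card (H G : sgraph) : iso H G -> #|H| = #|G|.
Proof. by move=> [f [fb _]]; apply: bij_eq_card fb. Qed.

(** An embedding is injective on vertices and on edges, so equal sizes force it to be onto for both.
    This makes [graph_size] a measure for induction along proper subgraphs. *)
Lemma subgraph_size (H G : sgraph) : subgraph H G ->
  graph_size H <= graph_size G /\ (graph_size G <= graph_size H -> iso H G).
Proof.
move=> sHG; have leV := subgraph_leq_card sHG; case: sHG => f [fi fh].
pose ff (e : H * H) := (f e.1, f e.2).
have ffi : injective ff by move=> [a b] [c e] [/fi -> /fi ->].
have sE : ff @: edges H \subset edges G.
  by apply/fintype.subsetP=> e /imsetP[e' + ->]; rewrite !inE; apply: fh.
have leE : #|edges H| <= #|edges G|.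
  by rewrite -(card_imset (edges H) ffi) subset_leq_card.
rewrite /graph_size; split; first exact: leq_add.
move=> le_size.
have eqV : #|G| <= #|H|.
  by rewrite -(leq_add2r #|edges G|) (leq_trans le_size) // leq_add2l.
have eqE : ff @: edges H = edges G.
  apply/eqP; rewrite eqEcard sE card_imset //.
  by rewrite -(leq_add2l #|G|) (leq_trans le_size) // leq_add2r.
exists f; split; first exact: inj_card_bij.
move=> x y; apply/idP/idP; last exact: fh.
move=> fxy; have: (f x, f y) \in edges G by rewrite inE.
by rewrite -eqE => /imsetP[[a b]]; rewrite inE => /= ab [/fi -> /fi ->].
Qed.

Lemma proper_subgraph_size (H G : sgraph) :
  proper_subgraph H G -> graph_size H < graph_size G.
Proof.
move=> [/subgraph_size[_ h] niso]; rewrite ltnNge.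
by apply/negP => /h.
Qed.

Lemma induced_sub (G : sgraph) (A B : {set G}) :
  A \subset B -> subgraph (induced_graph A) (induced_graph B).
Proof.
move=> /fintype.subsetP sAB.
exists (fun x : induced_graph A => exist _ (val x) (sAB _ (valP x)) : induced_graph B).
by split=> // x y [] /val_inj.
Qed.

Lemma subgraph_induced (H G : sgraph) (S : {set G}) (f : H -> G) :
  injective f -> (forall x y, adj x y -> adj (f x) (f y)) ->
  (forall x, f x \in S) -> subgraph H (induced_graph S).
Proof.
move=> fi fh fS; exists (fun x => exist _ (f x) (fS x) : induced_graph S).
by split=> [x y [] /fi|x y /fh].
Qed.

Lemma induced_subgraph (G : sgraph) (S : {set G}) : subgraph (induced_graph S) G.
Proof. by exists val; split=> //; apply: val_inj. Qed.

Lemma card_induced (G : sgraph) (S : {set G}) : #|induced_graph S| = #|S|.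
Proof. by rewrite card_sig; apply: eq_card => x; rewrite inE. Qed.

(** * Hereditary properties and minimal forbidden subgraphs *)

Section Hereditary.
Variable P : sgraph -> Prop.
Hypothesis Piso : graph_property P.
Hypothesis Pher : hereditary P.

(** Passes from single deletions to arbitrary subgraphs. If the embedding is not an isomorphism,
    then [G] has a vertex outside its image or an edge that is not the image of an edge of [H].
    Deleting it keeps the copy of [H] and lowers the size. *)
Lemma hereditary_subgraph (H G : sgraph) : subgraph H G -> P G -> P H.
Proof.
have [n] := ubnP (graph_size G); elim: n G => // n IHn G leGn sHG PG.
case: (pselect (iso G H)) => [/Piso|niso]; first by apply.
have IH G' : P G' -> subgraph H G' -> proper_subgraph G' G -> P H.
  move=> PG' sHG' /proper_subgraph_size lt'; apply: (IHn G') => //.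
  exact: leq_trans lt' leGn.
have [f [fi fh]] := sHG.
have [/forallP fonto|/forallPn[v vf]] := boolP [forall v, v \in codom f]; last first.
  apply: (IH (del_vertex v)); first exact: Pher.1.
    apply: (subgraph_induced (f := f)) => // x; rewrite !inE.
    by apply: contraNneq vf => <-; apply: codom_f.
  split; first exact: induced_subgraph.
  move=> /iso_card; rewrite card_induced cardsCs finset.setCK cards1 => E.
  have : #|G| - 1 < #|G| by rewrite ltn_subrL /=; apply/card_gt0P; exists v.
  by rewrite E ltnn.
have [/forallP hE|/forallPn[[x y]]] :=
  boolP [forall e : H * H, adj (f e.1) (f e.2) ==> adj e.1 e.2].
  case: niso; have fb : bijective f.
    apply: inj_card_bij => //; rewrite -(card_codom fi).
    by apply/subset_leq_card/fintype.subsetP => v _; apply: fonto.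
  have [g fK gK] := fb; exists g; split; first by exists f.
  move=> x y; apply/idP/idP => [/fh|]; first by rewrite !gK.
  by have := hE (g x, g y); rewrite /= !gK => /implyP.
rewrite negb_imply /= => /andP[fxy nxy].
apply: (IH (del_edge (f x) (f y))); first exact: Pher.2.
  exists f; split=> // a b ab; rewrite /= /del_edge_adj fh //=.
  apply: contra nxy => /eqP E.
  have /set2P[] : f a \in [set f x; f y] by rewrite -E !inE eqxx.
    move=> /fi ax; subst a.
    have /set2P[] : f b \in [set f x; f y] by rewrite -E !inE eqxx orbT.
      by move=> /fi bx; subst b; rewrite adj_irr in ab.
    by move=> /fi <-.
  move=> /fi ax; subst a.
  have /set2P[] : f b \in [set f x; f y] by rewrite -E !inE eqxx orbT.
    by move=> /fi <-; rewrite adj_sym.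
  by move=> /fi bx; subst b; rewrite adj_irr in ab.
have sub : subgraph (del_edge (f x) (f y)) G.
  by exists id; split=> // a b /andP[].
(* An isomorphism onto [G] would pull the edges of [G] back injectively, although the edge from
   [f x] to [f y] has been lost. *)
split=> // /[dup] /iso_card cE [g [gb gh]].
have cc : #|edges G| <= #|edges (del_edge (f x) (f y))|.
  have [g' gK g'K] := gb.
  have ggi : injective (fun e : G * G =>
      (g' e.1, g' e.2) : del_edge (f x) (f y) * del_edge (f x) (f y)).
    by move=> [a b] [c e] /= [] /(can_inj g'K) -> /(can_inj g'K) ->.
  rewrite -(card_imset (edges G) ggi); apply/subset_leq_card/fintype.subsetP => e.
  move=> /imsetP[[a b]]; rewrite !inE /= => ab -> /=.
  by have := gh (g' a) (g' b); rewrite !g'K ab => /esym.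
have : edges (del_edge (f x) (f y)) = edges G.
  apply/eqP; rewrite eqEcard cc andbT; apply/fintype.subsetP=> -[a b].
  by rewrite !inE => /andP[].
by move/finset.setP/(_ (f x, f y)); rewrite !inE /= fxy /del_edge_adj fxy /= eqxx.
Qed.

Lemma minimal_forbidden_sub (G : sgraph) :
  ~ P G -> exists2 F, minimal_forbidden P F & subgraph F G.
Proof.
have [n] := ubnP (graph_size G); elim: n G => // n IHn G leGn nPG.
case: (pselect (exists2 H, proper_subgraph H G & ~ P H)) => [[H pH nPH]|noH].
  have [|F mF sF] := IHn H _ nPH.
    exact: leq_trans (proper_subgraph_size pH) leGn.
  by exists F => //; apply: subgraph_trans sF pH.1.
exists G; last exact: subgraph_refl.
by split=> // H pH; apply: contrapT => nPH; apply: noH; exists H.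
Qed.

Lemma forbidden_degree_leq (d : nat) (F : sgraph) (x : F) :
  is_forbidden_degree P d -> minimal_forbidden P F -> d <= degree x.
Proof.
move=> [_ dmin] mF.
case: (@arg_minnP F x predT (@degree F)) => // y _ ymin.
apply: leq_trans (ymin x isT); apply: dmin mF _; split; first by exists y.
by move=> z; apply: ymin.
Qed.

End Hereditary.

(** * Adaptive composition of decision trees *)

(** The continuation [k] receives the positive answers on [s], so the next round of queries may
    depend on them. *)
Lemma query_all (V : finType) (c : nat) (s : seq V) (k : {set V} -> dtree V) :
  (forall A, depth (k A) <= c) ->
  exists t : dtree V, depth t <= size s + c /\
    forall S : {set V}, run t S = run (k [set x in s | x \in S]) S.
Proof.
elim: s k => [|x s IHs] k kc.
  exists (k finset.set0); split=> // S; congr (run (k _) S).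
have [t0 [d0 r0]] := IHs k kc.
have [t1 [d1 r1]] := IHs (fun A => k (x |: A)) (fun A => kc _).
exists (Query x t0 t1); split=> [|S] /=; first by rewrite addSn ltnS geq_max d0.
case: ifP => xS; rewrite (r0, r1); congr (run (k _) S); apply/finset.setP=> y.
  by rewrite !inE; case: eqP => [->|]; rewrite ?xS.
by rewrite !inE; case: eqP => [->|]; rewrite ?xS ?andbF.
Qed.

(** * The blow-up of a forbidden graph with pendant vertices *)

Section Construction.
Variables (F : sgraph) (v : F) (m q : nat) (Q : finType).

Definition nbr : finType := {x : F | adj v x}.

(** The first component selects the neighbours of a pendant. The second only separates pendants with
    the same neighbours, so injectivity allows at most [q] of these. *)
Variable code : Q -> {ffun nbr -> 'I_m} * 'I_q.

Definition host_adj (a b : F * 'I_m + Q) : bool :=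
  match a, b with
  | inl (x, i), inl (y, j) => adj x y || (x == y) && (i != j)
  | inl (x, i), inr p | inr p, inl (x, i) =>
      [exists w : nbr, (val w == x) && ((code p).1 w == i)]
  | inr _, inr _ => false
  end.

Lemma host_adj_sym : symmetric host_adj.
Proof. by move=> [[x i]|p] [[y j]|p'] //=; rewrite adj_sym eq_sym (eq_sym i). Qed.

Lemma host_adj_irr : irreflexive host_adj.
Proof. by move=> [[x i]|p] //=; rewrite adj_irr !eqxx. Qed.

Definition host : sgraph := SGraph host_adj_sym host_adj_irr.

Lemma card_host : #|host| = #|F| * m + #|Q|.
Proof. by rewrite card_sum card_prod card_ord. Qed.

Definition base : seq host := [seq inl e | e : F * 'I_m].

Lemma size_base : size base = #|F| * m.
Proof. by rewrite size_map -cardE card_prod card_ord. Qed.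

Definition row (S : {set host}) (x : F) : {set 'I_m} :=
  [set i | (inl (x, i) : host) \in S].

Definition live (S : {set host}) : {set Q} :=
  [set p | [forall w : nbr, (code p).1 w \in row S (val w)]].

Lemma card_nbr : #|nbr| = degree v.
Proof. by rewrite card_sig /degree cardsE; apply: eq_card => x; rewrite inE. Qed.

(** A live pendant is determined by its label in ['I_q] and one element from each of [degree v]
    rows. *)
Lemma card_live (S : {set host}) (k : nat) : injective code ->
  (forall x, #|row S x| <= k) -> #|live S| <= k ^ degree v * q.
Proof.
move=> ci rk; rewrite -(card_imset _ ci).
pose T := finset.setX [set g in family (fun w : nbr => row S (val w))] [set: 'I_q]%SET.
apply: (@leq_trans #|T|).
  apply/subset_leq_card/fintype.subsetP => _ /imsetP[p + ->].
  rewrite !inE andbT => /forallP h; apply/familyP => w; exact: h.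
rewrite cardsX cardsT card_ord cardsE card_family leq_mul2r; apply/orP; right.
rewrite -card_nbr cardT /image_mem enumT; elim: (Finite.enum nbr) => //= w s IHs.
by rewrite expnS leq_mul.
Qed.

(** A row induces a clique, which contains every graph on at most as many vertices. *)
Lemma row_clique (S : {set host}) (x : F) :
  #|F| <= #|row S x| -> subgraph F (induced_graph S).
Proof.
move=> le; pose g (y : F) := enum_val (widen_ord le (enum_rank y)).
have gi : injective g.
  by move=> y z /enum_val_inj /(congr1 val) /= /ord_inj /enum_rank_inj.
apply: (subgraph_induced (f := fun y => inl (x, g y) : host)).
- by move=> y z [] /gi.
- move=> y z yz; rewrite /= eqxx /= (inj_eq gi); apply/orP; right.
  by apply: contraTneq yz => ->; rewrite adj_irr.
- by move=> y; have := enum_valP (widen_ord le (enum_rank y)); rewrite inE.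
Qed.

(* A pendant with a neighbour outside [S] has degree less than [degree v] in
   the induced graph, too small for a vertex of a minimal forbidden graph. *)
Lemma dead_degree (S : {set host}) (H : sgraph) (f : H -> host) (x : H) (p : Q) :
  injective f -> (forall y z, adj y z -> adj (f y) (f z)) ->
  (forall y, f y \in S) -> f x = inr p -> p \notin live S ->
  degree x < degree v.
Proof.
move=> fi fh fS fx; rewrite inE => /forallPn[w0]; rewrite inE => w0S.
pose h (w : nbr) : host := inl (val w, (code p).1 w).
have sub : f @: [set y | adj x y] \subset h @: [set~ w0].
  apply/fintype.subsetP => _ /imsetP[y + ->]; rewrite inE => xy.
  have := fh _ _ xy; have := fS y; rewrite fx; case: (f y) => [[z i]|] //= zS.
  move=> /existsP[w /andP[/eqP wz /eqP wi]].
  apply/imsetP; exists w; last by rewrite /h -wz -wi.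
  by rewrite !inE; apply: contraNneq w0S => <-; rewrite /= wz wi.
rewrite -card_nbr /degree -(card_imset _ fi).
apply: leq_ltn_trans (subset_leq_card sub) _.
apply: leq_ltn_trans (leq_imset_card _ _) _.
rewrite cardsC1 ltn_predL; apply/card_gt0P; by exists w0.
Qed.

(** * Relevance of the host and the query strategy *)

Section Property.
Variable P : sgraph -> Prop.
Hypothesis Piso : graph_property P.
Hypothesis Pher : hereditary P.
Hypothesis dP : is_forbidden_degree P (degree v).
Hypothesis mF : minimal_forbidden P F.

(** The witness is the vertex set of the induced copy: it contains [F], while without [g x] it
    induces a proper subgraph of [F], which satisfies [P] by minimality. *)
Lemma copy_relevant (g : F -> host) (x : F) :
  injective g -> (forall y z, adj (g y) (g z) = adj y z) ->
  relevant_vertex P (g x).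
Proof.
move=> gi gh; have gadj y z : adj y z -> adj (g y) (g z) by rewrite gh.
exists (g @: [set: F]%SET); split; first by rewrite imset_f ?inE.
suff [nP yP] : ~ P (induced_graph (g @: [set: F]%SET)) /\
    P (induced_graph (g @: [set: F]%SET :\ g x)).
  by move=> [_ /(_ yP)].
split.
  move=> PS; apply: mF.1; apply: (hereditary_subgraph Piso Pher) PS.
  by apply: (subgraph_induced gi gadj) => y; rewrite imset_f ?inE.
apply: mF.2; split.
  have pre (y : induced_graph (g @: [set: F]%SET :\ g x)) : exists z, g z == val y.
    by case: y => y /= /setD1P[_ /imsetP[z _ ->]]; exists z; apply/eqP.
  pose f y := xchoose (pre y).
  have fP y : g (f y) = val y by have /eqP := xchooseP (pre y).
  exists f; split; first by move=> y z E; apply: val_inj; rewrite -!fP E.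
  by move=> y z; rewrite -gh !fP.
move=> /iso_card; rewrite card_induced => E.
have := cardsD1 (g x) (g @: [set: F]%SET).
by rewrite imset_f ?inE // E card_imset // cardsT add1n => /n_Sn.
Qed.

Lemma host_relevant : 0 < m -> relevant P host.
Proof.
move=> m0 [[x i]|p].
  (* The vertices with second coordinate [i] form an induced copy of [F]. *)
  apply: (@copy_relevant (fun y => inl (y, i)) x); first by move=> y z [].
  by move=> y z; rewrite /= eqxx andbF orbF.
(* The pendant replaces [v]. Each neighbour of [v] is represented by the vertex that [code p]
   prescribes; for all other vertices the choice is arbitrary. *)
pose a (y : F) : 'I_m :=
  if insub y is Some w then (code p).1 w else Ordinal m0.
have aw (w : nbr) : a (val w) = (code p).1 w by rewrite /a valK.
pose g (y : F) : host := if y == v then inr p else inl (y, a y).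
have <- : g v = inr p by rewrite /g eqxx.
have pend (z : F) : [exists w : nbr, (val w == z) && ((code p).1 w == a z)] = adj v z.
  apply/existsP/idP => [[w /andP[/eqP <- _]]|vz]; first exact: (valP w).
  by exists (Sub z vz); rewrite -aw SubK !eqxx.
apply: copy_relevant.
  by move=> y z; rewrite /g; case: eqP => [->|_]; case: eqP => [->|_] // [].
move=> y z; rewrite /g; case: eqP => [->|_]; case: eqP => [->|_] /=.
- by rewrite adj_irr.
- exact: pend.
- by rewrite pend adj_sym.
- by case: (y =P z) => [->|_]; rewrite ?eqxx ?andbF ?orbF.
Qed.

Definition live_base (S : {set host}) : {set host} :=
  [set x in base ++ [seq inr p | p in live S]].

(** All degrees in a minimal forbidden graph are at least [degree v], so by [dead_degree] its copies
    avoid the pendants that are not live. *)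
Lemma prune (S : {set host}) :
  P (induced_graph S) <-> P (induced_graph (S :&: live_base S)).
Proof.
split; first by apply/(hereditary_subgraph Piso Pher)/induced_sub/finset.subsetIl.
apply: contraPP => /(minimal_forbidden_sub)[H mH [f [fi fh]]] PS.
apply: mH.1; apply: (hereditary_subgraph Piso Pher) PS.
have gi : injective (fun x => val (f x)) by apply: inj_comp fi; apply: val_inj.
apply: (subgraph_induced gi) => [x y /fh //|x].
rewrite inE (valP (f x)) /= inE mem_cat.
case E : (val (f x)) => [e|p]; first by rewrite map_f ?mem_enum.
apply/orP; right; rewrite map_f // mem_enum.
apply: contraT => dead.
have := dead_degree gi (fun y z yz => fh y z yz) (fun y => valP (f y)) E dead.
by rewrite ltnNge (forbidden_degree_leq x dP mH).
Qed.

(** Hence the answers on the base alone tell which pendants to query next. *)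
Lemma live_base_eq (S : {set host}) : live (S :&: [set x in base]) = live S.
Proof.
apply/finset.setP => p; rewrite !inE; apply: eq_forallb => w.
by rewrite !inE map_f ?mem_enum ?andbT.
Qed.

Lemma host_decide : injective code -> exists t : dtree host,
  decides P t /\ depth t <= #|F| * m + #|F| ^ degree v * q.
Proof.
move=> ci.
have leafP (b : bool) (c : nat) : depth (Leaf host b) <= c by [].
have stage2 (B : {set host}) : exists t : dtree host,
    depth t <= #|live B| /\ forall S, run t S =
     `[< P (induced_graph (B :|: [set x in [seq inr p | p in live B] | x \in S])) >].
  have [t [dt rt]] := query_all [seq inr p | p in live B]
    (fun A => leafP `[< P (induced_graph (B :|: A)) >] 0).
  by exists t; rewrite size_map -cardE addn0 in dt.
(* A large row already contains [F], so [P] fails and no further query is made. *)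
pose k B := if [exists x, #|F| <= #|row B x|] then Leaf host false
            else projT1 (cid (stage2 B)).
have [|t [dt rt]] := @query_all host (#|F| ^ degree v * q) base k.
  move=> B; rewrite /k; case: ifPn => // /existsPn small.
  case: cid => t [/= dt _]; apply: leq_trans dt _.
  by apply: card_live => // x; rewrite ltnW // ltnNge.
exists t; split; last by rewrite -size_base.
(* After [prune], only vertices that the second stage knows about matter. *)
move=> S; rewrite rt prune /k.
set B := [set x in base | x \in S].
have BE : B = S :&: [set x in base] by apply/finset.setP => x; rewrite !inE andbC.
have liveE : live B = live S by rewrite BE live_base_eq.
case: ifPn => [/existsP[x big]|_].
  split=> // PS; case: mF.1; apply: (hereditary_subgraph Piso Pher) PS.
  apply: subgraph_trans (row_clique big) (induced_sub _).
  apply/fintype.subsetP => y; rewrite !inE => /andP[yb ->].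
  by rewrite mem_cat yb.
case: cid => t2 [/= _ ->]; rewrite liveE.
suff -> : B :|: [set x in [seq inr p | p in live S] | x \in S] = S :&: live_base S.
  by split=> /asboolP.
by apply/finset.setP => x; rewrite !inE mem_cat andb_orr andbC; congr (_ || _); rewrite andbC.
Qed.

End Property.
End Construction.

(** * Choice of parameters and the asymptotic bound *)

Lemma relevant_low_cost (P : sgraph -> Prop) (F : sgraph) (v : F) (m q n : nat) :
  graph_property P -> hereditary P -> is_forbidden_degree P (degree v) ->
  minimal_forbidden P F -> 0 < m -> #|F| * m <= n <= m ^ degree v * q ->
  (exists G : sgraph, relevant P G /\ #|G| = n) /\
  min_cost P n <= #|F| * m + #|F| ^ degree v * q.
Proof.
move=> Piso Pher dP mF m0 /andP[len nle].
(* The pendants bring the number of vertices to exactly [n]; the upper bound on [n] leaves enough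
   distinct codes for them. *)
pose N := n - #|F| * m.
have le : #|'I_N| <= #|{: {ffun nbr v -> 'I_m} * 'I_q}|.
  rewrite card_prod card_ffun !card_ord card_nbr.
  exact: leq_trans (leq_subr _ _) nle.
pose code (p : 'I_N) := enum_val (widen_ord le (enum_rank p)).
have ci : injective code.
  by move=> y z /enum_val_inj /(congr1 val) /= /ord_inj /enum_rank_inj.
have cG : #|host code| = n by rewrite card_host card_ord subnKC.
have rG : relevant P (host code) by apply: host_relevant mF m0.
split; first by exists (host code).
have [_ min_le] := @nat_minP
  (fun c => exists G : sgraph, relevant P G /\ #|G| = n /\ cost P G = c)
  _ (ex_intro _ _ (conj rG (conj cG erefl))).
apply: leq_trans (min_le _ _) _; first by exists (host code).
have [t [dt td]] := host_decide Piso Pher dP mF ci.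
have [_ cost_le] := @nat_minP
  (fun c => exists t : dtree (host code), decides P t /\ depth t = c)
  _ (ex_intro _ t (conj dt erefl)).
by apply: leq_trans (cost_le _ _) td; exists t.
Qed.

(** Take the largest [m] with [(k * m) ^ d.+1 <= n]. Maximality and [m.+1 <= 2 * m] give
    [n < (2 * k * m) ^ d.+1], which regroups as [m ^ d * q] with [q] proportional to [m]. *)
Lemma root_scale (k d n : nat) : 0 < k -> k ^ d.+1 <= n ->
  exists m, [/\ 0 < m, k * m <= n, m ^ d.+1 <= n & n <= m ^ d * ((2 * k) ^ d.+1 * m)].
Proof.
move=> k0 kn; pose p m := (k * m) ^ d.+1 <= n.
have leX a : a <= a ^ d.+1 by case: a => // a; rewrite -{1}(expn1 a.+1) leq_pexp2l.
have leM m : m <= k * m by rewrite leq_pmull.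
have p1 : exists m, p m by exists 1; rewrite /p muln1.
have pb m : p m -> m <= n.
  by move=> pm; apply: leq_trans (leM m) _; apply: leq_trans (leX _) pm.
case: (ex_maxnP p1 pb) => m pm mmax; exists m.
have m0 : 0 < m by apply: mmax; rewrite /p muln1.
split=> //.
- exact: leq_trans (leX _) pm.
- by apply: leq_trans pm; rewrite leq_exp2r.
- rewrite mulnCA -expnSr -expnMn; apply: ltnW.
  have : ~~ p m.+1 by apply/negP => /mmax; rewrite ltnn.
  rewrite /p -ltnNge => /leq_trans; apply; rewrite leq_exp2r //.
  by rewrite -mulnA mulnCA leq_mul2l; apply/orP; right; lia.
Qed.

Local Open Scope classical_set_scope.
Local Open Scope ring_scope.

(** The first conjunct ensures that for large [n] the value of [min_cost] is not its default [0]. *)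
Theorem theorem1 (R : realType) (P : sgraph -> Prop) (d : nat)
    (Piso : graph_property P) (Pher : hereditary P)
    (dP : is_forbidden_degree P d) :
  (\forall n \near \oo, exists G : sgraph, relevant P G /\ #|G| = n) /\
  (fun n : nat => (min_cost P n)%:R : R)
    =O_\oo (fun n : nat => n%:R `^ (d.+1%:R)^-1 : R).
Proof.
have [[F [mF [[v dv] _]]] _] := dP; subst d.
set d := degree v in dP *; pose k := #|F|.
have k0 : (0 < k)%N by apply/card_gt0P; exists v.
(* The cost [k * m + k ^ d * q] with [q = (2 * k) ^ d.+1 * m], divided by [m]. *)
pose C := (k + k ^ d * (2 * k) ^ d.+1)%N.
have main n : (k ^ d.+1 <= n)%N ->
    (exists G : sgraph, relevant P G /\ #|G| = n) /\
    exists2 m, (m ^ d.+1 <= n)%N & (min_cost P n <= C * m)%N.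
  move=> /(root_scale k0)[m [m0 km mn nm]].
  have kmn : (k * m <= n <= m ^ d * ((2 * k) ^ d.+1 * m))%N by rewrite km nm.
  have [ex le] := relevant_low_cost Piso Pher dP mF m0 kmn.
  by split=> //; exists m => //; rewrite mulnDl -mulnA.
split; first by exists (k ^ d.+1)%N => // n /main[].
apply/eqO_exP; exists C%:R; first by rewrite ltr0n addn_gt0 k0.
exists (k ^ d.+1)%N => // n /main[_ [m mn le]].
rewrite /= ger0_norm // ger0_norm ?powR_ge0 //.
apply: (@le_trans _ _ (C * m)%:R); first by rewrite ler_nat.
rewrite natrM ler_wpM2l //.
(* With [m] written as a root, [m ^ d.+1 <= n] and monotonicity of the power finish the bound. *)
have -> : m%:R = (m ^ d.+1)%:R `^ (d.+1%:R)^-1 :> R.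
  by rewrite natrX -powR_mulrn // -powRrM mulfV ?pnatr_eq0 // powRr1.
by apply: ge0_ler_powR; rewrite ?nnegrE ?invr_ge0 // ler_nat.
Qed.
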